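(* Let $k$ be a field and let $E=(E,P,L,d)$ be a fractional Brauer configuration with associated quiver $Q_E$. Then the ideal of $kQ_E$ generated by the relations (R2') is equal to the ideal of $kQ_E$ generated by the relations (R2) and (R3), where: (R2) consists of all paths $L(e_n)\cdots L(e_2)L(e_1)$ with $P(g(e_i))=P(e_{i+1})$ for each $1\le i\le n-1$ and $\bigcap_{i=1}^n g^{n-i}(L(e_i))=\emptyset$; (R3) consists of all paths $L(g^{n-1}(e))\cdots L(g(e))L(e)$ with $e\in E$ and $n>d(e)$; (R2') consists of all paths $L(e_n)\cdots L(e_2)L(e_1)$ in $Q_E$ that are not a subpath of any special path, but such that every proper subpath is a subpath of some special path in $Q_E$.
   Context: Paths are written from right to left; a subpath consists of consecutive arrows. A fractional Brauer configuration (f-BC) is a quadruple $E=(E,P,L,d)$ where $E$ is a $G$-set for $G=\langle g\rangle\cong(\mathbb Z,+)$, $P$ and $L$ are partitions of $E$ ($P(e)$, $L(e)$ denote the classes containing $e$), and $d:E\to\mathbb Z_{+}$ is a function to the positive integers, such that: (f1) $L(e)\subseteq P(e)$ and $P(e)$ is finite for each $e$; (f2) $L(e_1)=L(e_2)$ implies $P(g(e_1))=P(g(e_2))$; (f3) $d$ is constant on $\langle g\rangle$-orbits; (f4) $P(e_1)=P(e_2)$ iff $P(g^{d(e_1)}(e_1))=P(g^{d(e_2)}(e_2))$; (f5) $L(e_1)=L(e_2)$ iff $L(g^{d(e_1)}(e_1))=L(g^{d(e_2)}(e_2))$; (f6) for all $e,h\in E$ the formal sequence $L(g^{d(e)-1}(e))\cdots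 L(g(e))L(e)$ is not a proper subsequence (of consecutive terms) of $L(g^{d(h)-1}(h))\cdots L(g(h))L(h)$. The quiver $Q_E$ has vertices the classes $P(e)$ and arrows the classes $L(e)$ ($e\in E$), where the arrow $L(e)$ goes from $P(e)$ to $P(g(e))$. For $e\in E$, the path $L(g^{d(e)-1}(e))\cdots L(g(e))L(e)$ is called the special path starting at $e$. *)

(* Defs.v *)
From HB Require Import structures.
From mathcomp Require Import all_boot all_algebra.
From mathcomp Require Import finmap boolp classical_sets cardinality.
From mathcomp Require Import monalg.
Set Implicit Arguments.
Unset Strict Implicit.
Unset Printing Implicit Defensive.
Import GRing.Theory.
Local Open Scope classical_set_scope.
Local Open Scope ring_scope.

(** * Quivers, paths and path algebras *)

Record quiver := Quiver {
  qvert : choiceType;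
  qarr : choiceType;
  qsrc : qarr -> qvert;
  qtgt : qarr -> qvert
}.

Section Paths.
Variable Q : quiver.

(* Arrow sequences are stored in the order of traversal: the path written
   a_n ... a_2 a_1 from right to left is the sequence [:: a_1; ...; a_n]. *)
Fixpoint walk (v : qvert Q) (s : seq (qarr Q)) : bool :=
  if s is a :: s' then (qsrc a == v) && walk (qtgt a) s' else true.

Definition walk_end (v : qvert Q) (s : seq (qarr Q)) : qvert Q :=
  last v (map (@qtgt Q) s).

(* The starting vertex is recorded so that there is one trivial path (with no
   arrow) at each vertex. *)
Record qpath := QPath {
  pval : qvert Q * seq (qarr Q);
  _ : walk pval.1 pval.2
}.

HB.instance Definition _ := [isSub for pval].
HB.instance Definition _ := [Choice of qpath by <:].

Definition pstart (p : qpath) : qvert Q := (pval p).1.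
Definition parr (p : qpath) : seq (qarr Q) := (pval p).2.
Definition pend (p : qpath) : qvert Q := walk_end (pstart p) (parr p).

Definition subpath (p q : qpath) : Prop :=
  exists s t : seq (qarr Q),
    parr q = s ++ parr p ++ t /\ pstart p = walk_end (pstart q) s.

Lemma walk_cat v s t : walk v (s ++ t) = walk v s && walk (walk_end v s) t.
Proof. by elim: s v => //= a s IH v; rewrite IH andbA. Qed.

(* The composite qp (first p, then q), when p ends where q starts. *)
Definition qcomp (q p : qpath) : option qpath :=
  if pend p == pstart q then insub (pstart p, parr p ++ parr q) else None.

Lemma qcompP (q p : qpath) : pend p = pstart q ->
  exists2 r, qcomp q p = Some r & pval r = (pstart p, parr p ++ parr q).
Proof.
rewrite /qcomp => e; rewrite e eqxx; case: insubP => [r _ <-|]; first by exists r.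
by rewrite /= walk_cat -/(pend p) e (valP p) (valP q).
Qed.

Variable k : fieldType.

Local Notation pathalg := {malg k[qpath]}.

Definition pa_basis (p : qpath) : pathalg := mkmalgU p 1.

Definition pa_mul (x y : pathalg) : pathalg :=
  \sum_(q <- msupp x) \sum_(p <- msupp y)
     (if qcomp q p is Some r then (mcoeff q x * mcoeff p y) *: pa_basis r
      else 0).

Definition is_ideal (I : set pathalg) : Prop :=
  [/\ I 0,
      forall x y, I x -> I y -> I (x + y),
      forall (c : k) x, I x -> I (c *: x),
      forall a x, I x -> I (pa_mul a x)
    & forall a x, I x -> I (pa_mul x a)].

Definition ideal_gen (S : set qpath) : set pathalg :=
  smallest is_ideal (pa_basis @` S).

End Paths.

Arguments ideal_gen {Q} k S _.

(** * Fractional Brauer configurations *)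

Definition cls (E : Type) (P : set (set E)) (e : E) : set E := pblock P id e.

Record fBC := FBC {
  fE : Type;
  (* action of the infinite cyclic group <g>: [gact n e] is g^n(e) *)
  gact : int -> fE -> fE;
  fP : set (set fE);
  fL : set (set fE);
  fd : fE -> nat;
  gact0 : forall e, gact 0 e = e;
  gactD : forall m n e, gact (m + n) e = gact m (gact n e);
  fP_partition : partition fP id setT;
  fL_partition : partition fL id setT;
  fd_gt0 : forall e, (0 < fd e)%N;
  fBC_f1 : forall e, cls fL e `<=` cls fP e /\ finite_set (cls fP e);
  fBC_f2 : forall e1 e2, cls fL e1 = cls fL e2 ->
         cls fP (gact 1 e1) = cls fP (gact 1 e2);
  fBC_f3 : forall (m : int) e, fd (gact m e) = fd e;
  fBC_f4 : forall e1 e2, cls fP e1 = cls fP e2 <->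
         cls fP (gact (fd e1)%:Z e1) = cls fP (gact (fd e2)%:Z e2);
  fBC_f5 : forall e1 e2, cls fL e1 = cls fL e2 <->
         cls fL (gact (fd e1)%:Z e1) = cls fL (gact (fd e2)%:Z e2);
  fBC_f6 : let Lseq e := [seq cls fL (gact i%:Z e) | i <- iota 0 (fd e)] in
       forall e h, ~ (infix (Lseq e) (Lseq h) /\ Lseq e <> Lseq h)
}.

Arguments fP : clear implicits.
Arguments fL : clear implicits.

Section Classes.
Variables (E : Type) (P : set (set E)).
Hypothesis partP : partition P id setT.

Lemma clsP e : P (cls P e) /\ cls P e e.
Proof.
case: partP => cov _ _; rewrite /cls /pblock /pblock_index /=.
have : cover P id e by rewrite cov.
by case=> A PA Ae; apply: (@xgetPex _ _ [set i | P i /\ i e]); exists A.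
Qed.

Lemma cls_eq A e : P A -> A e -> cls P e = A.
Proof.
move=> PA Ae; case: partP => _ triv _; have [Pe ee] := clsP e.
by apply: triv => //; exists e.
Qed.

Definition class_of (e : E) : set_type P :=
  exist _ (cls P e) (mem_set (clsP e).1).

Lemma class_inhabited (A : set_type P) : exists e, val A e.
Proof. by case: partP => _ _ /(_ _ (set_valP A)). Qed.

Definition class_repr (A : set_type P) : E := sval (cid (class_inhabited A)).

Lemma class_reprK A : class_of (class_repr A) = A.
Proof.
apply: val_inj => /=; apply: cls_eq; first exact: (set_valP A).
exact: (svalP (cid (class_inhabited A))).
Qed.

Lemma cls_class_repr e : cls P (class_repr (class_of e)) = cls P e.
Proof. exact: (congr1 val (class_reprK (class_of e))). Qed.

End Classes.

Section QuiverOfE.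
Variable E : fBC.

(* Source and target are computed on a chosen representative; [QE_src] and
   [QE_tgt] show that the choice is immaterial. *)
Definition QE : quiver :=
  let repr := class_repr (fL_partition E) in
  @Quiver (set_type (fP E)) (set_type (fL E))
    (fun a => class_of (fP_partition E) (repr a))
    (fun a => class_of (fP_partition E) (gact 1 (repr a))).

Definition Pcls (e : fE E) : qvert QE := class_of (fP_partition E) e.
Definition Lcls (e : fE E) : qarr QE := class_of (fL_partition E) e.

Lemma QE_src e : qsrc (Lcls e) = Pcls e.
Proof.
apply: val_inj => /=; apply: cls_eq (clsP (fP_partition E) _).1 _.
- exact: fP_partition.
set r := class_repr _ _.
have /(fBC_f1 _).1 : cls (fL E) e r.
  rewrite -(cls_class_repr (fL_partition E) e).
  exact: (clsP (fL_partition E) _).2.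
by [].
Qed.

Lemma QE_tgt e : qtgt (Lcls e) = Pcls (gact 1 e).
Proof. by apply: val_inj => /=; apply: fBC_f2; apply: cls_class_repr. Qed.

Definition Lseq (e : fE E) (n : nat) : seq (qarr QE) :=
  [seq Lcls (gact i%:Z e) | i <- iota 0 n].

Lemma walk_Lseq e n : walk (Pcls e) (Lseq e n).
Proof.
have H m : walk (Pcls (gact m%:Z e)) [seq Lcls (gact i%:Z e) | i <- iota m n].
  elim: n m => [//|n IH] m.
  rewrite [walk _ _]/(_ && walk (qtgt (Lcls (gact m%:Z e))) _) QE_src eqxx.
  by rewrite QE_tgt -gactD -PoszD; apply: IH.
by move: (H 0%N); rewrite gact0.
Qed.

Definition special (e : fE E) : qpath QE :=
  @QPath _ (Pcls e, Lseq e (fd e)) (walk_Lseq e (fd e)).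

Definition relR2 : set (qpath QE) := [set p |
  exists (n : nat) (e : nat -> fE E),
    [/\ (0 < n)%N,
        parr p = [seq Lcls (e i) | i <- iota 1 n],
        forall i, (1 <= i <= n.-1)%N ->
          cls (fP E) (gact 1 (e i)) = cls (fP E) (e i.+1)
      & \bigcap_(i in [set i | (1 <= i <= n)%N])
          (gact (n - i)%N%:Z @` cls (fL E) (e i)) = set0]].

Definition relR3 : set (qpath QE) := [set p |
  exists (e : fE E) (n : nat), (fd e < n)%N /\ parr p = Lseq e n].

Definition relR2' : set (qpath QE) := [set p |
  [/\ parr p <> [::],
      forall e, ~ subpath p (special e)
    & forall q, subpath q p -> q <> p ->
        exists e, subpath q (special e)]].

End QuiverOfE.

(* Main.v *)
Require Import Defs.
From mathcomp Require Import all_boot all_algebra.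
From mathcomp Require Import boolp classical_sets.
From mathcomp Require Import finmap monalg zify.
Import GRing.Theory.
Set Implicit Arguments.
Unset Strict Implicit.
Unset Printing Implicit Defensive.
Local Open Scope classical_set_scope.

(** Call a path good if it is a subpath of some special path.  Two facts drive
    the proof.

    An ideal of the path algebra that contains a path contains every path
    through it.  Hence [ideal_gen k S1] lies in [ideal_gen k S2] as soon as
    every path of [S1] has a subpath in [S2] ([ideal_gen_sub]).

    The arrows of a good path are L(f), L(g(f)), ..., L(g^(n-1)(f)) for some f,
    because the interval that a subpath cuts out of the special path at e is
    again an orbit segment, starting at some f = g^m(e).  Conversely such a
    segment is good when n <= d(f), being an initial part of the special path
    at f.  So a bad path can arise in two ways.  Either its arrows follow no
    g-orbit at all, which is (R2), since a common point of the sets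
    g^(n-i)(L(e_i)) is the same thing as an element f whose orbit they follow
    ([bigcap_shift_Lseq]); or they follow the orbit of some e for longer than
    d(e), which is (R3).  Every path of (R2) is then clearly bad.  For (R3) this
    is less obvious, as the same arrows might also follow the orbit of another
    element with a larger value of d; that is what (f6) rules out
    ([relR3_bad]).

    The paths of (R2') are the bad paths all of whose proper subpaths are good.
    Each of them is therefore in (R2) or (R3); conversely every path in (R2) or
    (R3) is bad, and a bad path contains a minimal bad path. *)

(** * Subpaths and ideals of the path algebra *)

Section PathIdeals.
Variable Q : quiver.
Implicit Types (p q r : qpath Q) (S : set (qpath Q)).

Lemma walk_end_cat (v : qvert Q) s t :
  walk_end v (s ++ t) = walk_end (walk_end v s) t.
Proof. by rewrite /walk_end map_cat last_cat. Qed.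

Lemma subpath_refl p : subpath p p.
Proof. by exists [::], [::]; rewrite cats0. Qed.

Lemma subpath_trans q p r : subpath p q -> subpath q r -> subpath p r.
Proof.
move=> [s [t [eq_pq st_pq]]] [s' [t' [eq_qr st_qr]]].
exists (s' ++ s), (t ++ t'); rewrite eq_qr eq_pq !catA; split=> //.
by rewrite walk_end_cat -st_qr.
Qed.

(** A nonempty path starts at the source of its first arrow, so only the arrow
    sequences need to be compared. *)
Lemma subpath_nonempty p q s t :
  parr p <> [::] -> parr q = s ++ parr p ++ t -> subpath p q.
Proof.
move=> p_n0 eq_q; exists s, t; split=> //.
have := valP q; rewrite -/(pstart q) -/(parr q) eq_q walk_cat walk_cat.
case/and3P=> _ + _; have := valP p; rewrite -/(pstart p) -/(parr p).
by case: (parr p) p_n0 => //= a u _ /andP[/eqP <- _] /andP[/eqP <- _].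
Qed.

Lemma proper_subpath_size p q :
  subpath q p -> q <> p -> (size (parr q) < size (parr p))%N.
Proof.
move=> [s [t [eq_p st]]] neq; rewrite ltnNge; apply/negP => le_pq; apply: neq.
move: le_pq; rewrite eq_p !size_cat => le_pq.
have /size0nil s0 : size s = 0%N by lia.
have /size0nil t0 : size t = 0%N by lia.
move: eq_p st; rewrite s0 t0 cats0 => /= eq_p st; apply: val_inj.
by rewrite [LHS]surjective_pairing [RHS]surjective_pairing; congr pair.
Qed.

Lemma walk_nth (v : qvert Q) s a i : walk v s -> (i.+1 < size s)%N ->
  qtgt (nth a s i) = qsrc (nth a s i.+1).
Proof.
elim: s v i => //= b s IH v [|i] /andP[_ w] lt_i; last exact: IH w lt_i.
by case: s w {IH} lt_i => //= c s /andP[/eqP].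
Qed.

Variable k : fieldType.

Lemma pa_mul_basis q p r : qcomp q p = Some r ->
  pa_mul (pa_basis k q) (pa_basis k p) = pa_basis k r.
Proof.
move=> e; rewrite /pa_mul /pa_basis !msuppU oner_eq0 !big_seq_fset1 e.
by rewrite !mcoeffUU mulr1 scale1r.
Qed.

Lemma ideal_subpath (I : set {malg k[qpath Q]}) p q : is_ideal I ->
  subpath q p -> I (pa_basis k q) -> I (pa_basis k p).
Proof.
move=> [_ _ _ Il Ir] [s [t [eq_p st]]] Iq.
have := valP p; rewrite -/(pstart p) -/(parr p) eq_p !walk_cat -st.
case/and3P=> ws wq wt.
pose ps := @QPath Q (pstart p, s) ws; pose pt := @QPath Q (pend q, t) wt.
have [r qs_r val_r] : exists2 r, qcomp q ps = Some r &
  pval r = (pstart p, s ++ parr q) by apply: qcompP; rewrite st.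
have [r' tr_r' val_r'] : exists2 r', qcomp pt r = Some r' &
    pval r' = (pstart r, parr r ++ t).
  apply: qcompP.
  by rewrite /pend /pstart /parr val_r /= walk_end_cat -st.
have -> : p = r'.
  apply: val_inj; rewrite [RHS]val_r' /pstart /parr val_r /= -catA -eq_p.
  by rewrite [LHS]surjective_pairing.
rewrite -(pa_mul_basis tr_r'); apply: Il.
by rewrite -(pa_mul_basis qs_r); apply: Ir.
Qed.

Lemma ideal_gen_sub S1 S2 :
  (forall p, S1 p -> exists2 q, S2 q & subpath q p) ->
  ideal_gen k S1 `<=` ideal_gen k S2.
Proof.
move=> S12 x S1x I [idI S2I]; apply: S1x; split=> // _ [p S1p <-].
have [q S2q qp] := S12 p S1p.
by apply: ideal_subpath idI qp _; apply: S2I; exists q.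
Qed.

End PathIdeals.

(** * Orbit segments *)

Section OrbitSegments.
Variable E : fBC.
Implicit Types (e f h : fE E) (p q : qpath (QE E)).

Lemma size_Lseq e n : size (Lseq e n) = n.
Proof. by rewrite size_map size_iota. Qed.

Lemma Lseq_add e m n :
  Lseq e (m + n) = Lseq e m ++ Lseq (gact m%:Z e) n.
Proof.
rewrite /Lseq iotaD map_cat add0n; congr (_ ++ _).
rewrite -[in LHS](addn0 m) iotaDl -map_comp; apply: eq_map => i /=.
by rewrite -gactD -PoszD addnC.
Qed.

Lemma Lseq_infix e N s u t : Lseq e N = s ++ u ++ t ->
  u = Lseq (gact (size s)%:Z e) (size u).
Proof.
move=> eq_sut; have := congr1 size eq_sut; rewrite size_Lseq !size_cat => eN.
move: eq_sut; rewrite eN !Lseq_add => /eqP.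
rewrite eqseq_cat ?size_Lseq // => /andP[_].
by rewrite eqseq_cat ?size_Lseq // => /andP[/eqP].
Qed.

Lemma Lcls_eq e f : Lcls e = Lcls f <-> cls (fL E) e = cls (fL E) f.
Proof.
by split=> [/(congr1 val)//|ef]; apply: val_inj.
Qed.

(** The common point and the start of the orbit segment determine each other:
    the point is g^(n-1)(f). *)
Lemma bigcap_shift_Lseq n (e : nat -> fE E) : (0 < n)%N ->
  \bigcap_(i in [set i | (1 <= i <= n)%N])
     (gact (n - i)%N%:Z @` cls (fL E) (e i)) !=set0 <->
  exists f, [seq Lcls (e i) | i <- iota 1 n] = Lseq f n.
Proof.
have partL := fL_partition E.
move=> n_gt0; split=> [[x capx]|[f eq_ef]].
  exists (gact (- n.-1%:Z) x); rewrite /Lseq (iotaDl 1 0) -map_comp.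
  apply/eq_in_map => i; rewrite mem_iota /= add0n add1n => lt_in.
  have [|y ey eq_x] := capx i.+1; first by rewrite /= lt_in.
  apply/Lcls_eq; apply/esym/(cls_eq partL); first exact: (clsP partL _).1.
  suff -> : gact i%:Z (gact (- n.-1%:Z) x) = y by [].
  rewrite -eq_x -!gactD -[RHS]gact0; congr (gact _ y).
  lia.
exists (gact n.-1%:Z f) => -[//|i] /= lt_in.
exists (gact i%:Z f); last by rewrite -gactD -PoszD; congr (gact _%:Z f); lia.
have /Lcls_eq -> : Lcls (e i.+1) = Lcls (gact i%:Z f).
  have a0 := Lcls f.
  have := congr1 (fun s => nth a0 s i) eq_ef.
  by rewrite !(nth_map 0%N) ?size_iota // !nth_iota.
exact: (clsP partL _).2.
Qed.

(** * Good and bad paths *)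

Definition good p := exists e, subpath p (special e).

Lemma good_Lseq p : good p -> exists f, parr p = Lseq f (size (parr p)).
Proof. by case=> e [s [t [/Lseq_infix eq_p _]]]; eexists; apply: eq_p. Qed.

Lemma Lseq_good p f n : parr p <> [::] -> parr p = Lseq f n ->
  (n <= fd f)%N -> good p.
Proof.
move=> p_n0 eq_p le_nd; exists f.
apply: (@subpath_nonempty _ _ _ [::] (Lseq (gact n%:Z f) (fd f - n))) => //.
by rewrite /= eq_p -Lseq_add subnKC.
Qed.

(** Every vertex is the class P(e) of some e, where a special path starts. *)
Lemma trivial_good p : parr p = [::] -> good p.
Proof.
move=> p0; pose e := class_repr (fP_partition E) (pstart p).
exists e, [::], (Lseq e (fd e)); rewrite p0; split=> //.
exact: (esym (class_reprK (fP_partition E) (pstart p))).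
Qed.

Lemma relR2_bad p : relR2 p -> ~ good p.
Proof.
move=> [n [e [n_gt0 eq_p _ cap0]]] /good_Lseq[f]; rewrite eq_p.
rewrite size_map size_iota => eq_f.
have /set0P : \bigcap_(i in [set i | (1 <= i <= n)%N])
     (gact (n - i)%N%:Z @` cls (fL E) (e i)) !=set0.
  by apply/bigcap_shift_Lseq => //; exists f.
by rewrite cap0 eqxx.
Qed.

(** This is where (f6) enters: the first d(e) arrows of the path form the
    special path at e, and they would be a proper part of another one. *)
Lemma relR3_bad p : relR3 p -> ~ good p.
Proof.
move=> [e [n [lt_dn eq_p]]] [h [s [t [eq_h _]]]].
have cls_Lseq f : [seq cls (fL E) (gact i%:Z f) | i <- iota 0 (fd f)] =
                  map val (Lseq f (fd f)) by rewrite -map_comp.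
have := @fBC_f6 E e h; rewrite /= !cls_Lseq; apply; split.
  change (Lseq h (fd h) = s ++ parr p ++ t) in eq_h.
  rewrite eq_h eq_p -(subnKC (ltnW lt_dn)) Lseq_add -catA !map_cat.
  exact: infix_infix.
move=> /(congr1 size); rewrite !size_map !size_iota => eq_d.
have := congr1 size eq_h; rewrite size_Lseq !size_cat eq_p size_Lseq -eq_d.
lia.
Qed.

Lemma bad_relR23 p : ~ good p -> relR2 p \/ relR3 p.
Proof.
move=> badp; have p_n0 : parr p <> [::] by move/trivial_good.
set n := size (parr p).
have n_gt0 : (0 < n)%N by rewrite lt0n size_eq0; apply/eqP.
have [a0 _] : exists a : qarr (QE E), True.
  by case: (parr p) p_n0 => // a; exists a.
(* The elements are numbered from 1, the arrows of the list from 0. *)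
pose e i := class_repr (fL_partition E) (nth a0 (parr p) i.-1).
have Lcls_e i : Lcls (e i) = nth a0 (parr p) i.-1 by apply: class_reprK.
have eq_p : parr p = [seq Lcls (e i) | i <- iota 1 n].
  rewrite (iotaDl 1 0) -map_comp -[LHS](mkseq_nth a0); apply: eq_map => i.
  by rewrite /= Lcls_e.
have [|] := pselect (exists f, parr p = Lseq f n).
  case=> f eq_f; right; exists f, n; split=> //.
  by rewrite ltnNge; apply/negP => /(Lseq_good p_n0 eq_f).
move=> noseg; left; exists n, e; split=> //; last first.
  apply/eqP/negPn/negP => /set0P /(bigcap_shift_Lseq _ n_gt0).
  by rewrite -eq_p.
move=> [//|i] /= lt_in.
suff /(congr1 val) : Pcls (gact 1 (e i.+1)) = Pcls (e i.+2) by [].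
rewrite -(QE_src (e i.+2)) -QE_tgt !Lcls_e /=; apply: walk_nth (valP p) _.
by rewrite -/(parr p) -/n; lia.
Qed.

(** A proper subpath has fewer arrows, so replacing a bad path by a bad proper
    subpath must end. *)
Lemma bad_has_minimal p : ~ good p -> exists2 q, relR2' q & subpath q p.
Proof.
have [m] := ubnP (size (parr p)); elim: m p => // m IH p lt_pm badp.
have [allgood|] :=
  pselect (forall q, subpath q p -> q <> p -> good q).
  exists p; last exact: subpath_refl.
  split=> [/trivial_good //|e pe|//]; by apply: badp; exists e.
move=> /existsNP[q /not_implyP[qp /not_implyP[neq badq]]].
have [|r R2r rq] := IH q _ badq.
  by apply: leq_trans (proper_subpath_size qp neq) _.
by exists r => //; apply: subpath_trans rq qp.
Qed.

End OrbitSegments.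

Theorem lemma2p6 (k : fieldType) (E : fBC) :
  ideal_gen k (@relR2' E) = ideal_gen k (@relR2 E `|` @relR3 E).
Proof.
apply/seteqP; split; apply: ideal_gen_sub => p.
  move=> [_ badp _]; exists p; last exact: subpath_refl.
  by apply: bad_relR23 => -[e]; apply: badp.
by case=> [/relR2_bad|/relR3_bad]; apply: bad_has_minimal.
Qed.
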